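(* Let $G$ be an $r$-uniform hypergraph and let $p>r$ be real. For a vertex $v$ let $d_v$ denote its degree. Then \[ \lambda^{(p)}(G)\leq\Bigg(r\sum_{e\in E(G)}\prod_{v\in e}d_v^{1/(p-r)}\Bigg)^{(p-r)/p}. \]
   Context: An $r$-uniform hypergraph $G$ consists of a finite vertex set $V(G)=\{1,\dots,n\}$ and a set $E(G)$ of $r$-element subsets of $V(G)$ (edges). The degree $d_v$ of a vertex $v$ is the number of edges containing $v$. For $\bm{x}\in\mathbb{R}^n$ let $P_G(\bm{x})=r\sum_{\{i_1,\ldots,i_r\}\in E(G)}x_{i_1}\cdots x_{i_r}$, and for real $p\ge1$ let $\|\bm{x}\|_p=(|x_1|^p+\cdots+|x_n|^p)^{1/p}$. The $p$-spectral radius of $G$ is $\lambda^{(p)}(G)=\max_{\|\bm{x}\|_p=1}P_G(\bm{x})$. *)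

(* Defs.v *)
From HB Require Import structures.
From mathcomp Require Import all_boot all_order all_algebra.
From mathcomp Require Import all_classical all_reals all_analysis.

Set Implicit Arguments.
Unset Strict Implicit.
Unset Printing Implicit Defensive.

Import Order.TTheory GRing.Theory Num.Theory.
Import numFieldNormedType.Exports.

Local Open Scope classical_set_scope.
Local Open Scope ring_scope.

Record hypergraph (n r : nat) := Hypergraph {
  edges : {set {set 'I_n}};
  edges_uniform : forall e, e \in edges -> #|e| = r }.

Definition degree (n r : nat) (G : hypergraph n r) (v : 'I_n) : nat :=
  #|[set e in edges G | v \in e]|.

Definition polyform (R : realType) (n r : nat) (G : hypergraph n r)
    (x : 'rV[R]_n) : R :=
  r%:R * \sum_(e in edges G) \prod_(i in e) x ord0 i.

Definition pnorm (R : realType) (n : nat) (p : R) (x : 'rV[R]_n) : R :=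
  (\sum_(i < n) `|x ord0 i| `^ p) `^ p^-1.

(* The supremum is a maximum as soon as n > 0: see p_spectral_radius_max below.
   For n = 0 the sphere is empty and the library's convention is sup set0 = 0. *)
Definition p_spectral_radius (R : realType) (n r : nat) (G : hypergraph n r)
    (p : R) : R :=
  sup [set polyform G x | x in [set x : 'rV[R]_n | pnorm p x = 1]].

Lemma continuous_normr_powR (R : realType) (p : R) :
  0 < p -> continuous (fun t : R => `|t| `^ p).
Proof.
move=> p0 t; have [->|t0] := eqVneq t 0.
  rewrite /continuous_at normr0 powR0 ?gt_eqF//; apply/cvgrPdist_lt => e e0.
  near=> s; rewrite sub0r normrN ger0_norm ?powR_ge0//.
  have -> : e = (e `^ p^-1) `^ p by rewrite -powRrM mulVf ?gt_eqF// powRr1 ?ltW.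
  apply: gt0_ltr_powR; rewrite ?nnegrE ?powR_ge0//.
  near: s; apply: cvgr0_norm_lt; first exact: cvg_id.
  exact: powR_gt0.
have h1 : {for t, continuous (Num.norm : R -> R)} by exact: norm_continuous.
have h2 : {for `|t|, continuous (fun s : R => s `^ p)}.
  apply/differentiable_continuous/derivable1_diffP.
  by apply: derivable_powR; rewrite in_itv/= normr_gt0 t0.
exact: (continuous_comp h1 h2).
Unshelve. all: by end_near. Qed.

Lemma pnorm_eq1 (R : realType) (n : nat) (p : R) (x : 'rV[R]_n) : 0 < p ->
  pnorm p x = 1 <-> \sum_(i < n) `|x ord0 i| `^ p = 1.
Proof.
move=> p0; rewrite /pnorm; set s := \sum_(i < n) _.
have s0 : 0 <= s by apply: sumr_ge0 => i _; exact: powR_ge0.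
split => [h|->]; last by rewrite powR1.
have : (s `^ p^-1) `^ p = s by rewrite -powRrM mulVf ?gt_eqF// powRr1.
by rewrite h powR1 => <-.
Qed.

Lemma p_spectral_radius_max (R : realType) (n r : nat) (G : hypergraph n r)
    (p : R) : (0 < n)%N -> 0 < p ->
  exists2 x : 'rV[R]_n, pnorm p x = 1 /\ polyform G x = p_spectral_radius G p
    & forall y, pnorm p y = 1 -> polyform G y <= p_spectral_radius G p.
Proof.
move=> n0 p0; pose A := [set x : 'rV[R]_n | pnorm p x = 1].
have AE : A = (fun x : 'rV[R]_n => \sum_(i < n) `|x ord0 i| `^ p) @^-1` [set 1].
  by apply/seteqP; split => x /(pnorm_eq1 _ p0).
have A0 : A !=set0.
  exists (delta_mx ord0 (Ordinal n0)); apply/pnorm_eq1 => //.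
  rewrite (bigD1 (Ordinal n0))//= mxE !eqxx normr1 powR1 big1 ?addr0// => i i0.
  by rewrite mxE (negbTE i0) andbF normr0 powR0 ?gt_eqF.
have cA : compact A.
  apply: bounded_closed_compact.
    exists 1; split => // M M1 x /(pnorm_eq1 _ p0) Ax.
    rewrite /= [leLHS]/Num.Def.normr/= mx_normrE; apply: bigmax_le => [|[i j] _ /=].
      by rewrite ltW// (lt_trans _ M1).
    rewrite (ord1 i) (le_trans _ (ltW M1))// leNgt; apply/negP => xj.
    suff : 1 < 1 :> R by rewrite ltxx.
    rewrite -[ltRHS]Ax (bigD1 j)//= ltr_wpDr//.
      by apply: sumr_ge0 => k _; exact: powR_ge0.
    by have := gt0_ltr_powR p0 _ _ xj; rewrite powR1; apply; rewrite nnegrE.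
  rewrite AE; apply: preimage_closed; last exact: closed_eq.
  move=> x _; move: x; apply: continuous_big => [|i _ x].
    exact: add_continuous.
  exact: (continuous_comp (@coord_continuous _ _ _ ord0 i x)
                          (@continuous_normr_powR _ _ p0 _)).
have cs : continuous
    (fun x : 'rV[R]_n => \sum_(e in edges G) \prod_(i in e) x ord0 i).
  apply: continuous_big => [|e _]; first exact: add_continuous.
  apply: continuous_big => [|i _]; first exact: mul_continuous.
  exact: coord_continuous.
have cf : continuous (@polyform R n r G).
  move=> x; apply: (@continuousM _ _ (fun=> r%:R) _ x _ (cs x)).
  exact: cst_continuous.
have [c cA' cmax] := EVT_max_rV A0 cA (continuous_subspaceT cf).
rewrite inE in cA'.
have ub : has_ubound [set polyform G x | x in A].
  by exists (polyform G c) => _ [y Ay <-]; apply: cmax; rewrite inE.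
have lamE : polyform G c = p_spectral_radius G p.
  apply/eqP; rewrite eq_le; apply/andP; split.
    by apply: ub_le_sup => //; exists c.
  apply: ge_sup; first by exists (polyform G c), c.
  by move=> _ [y Ay <-]; apply: cmax; rewrite inE.
by exists c => // y Ay; apply: ub_le_sup => //; exists y.
Qed.

(* Main.v *)
(** By AM-GM, an edge [e] satisfies
      \prod_(v in e) |x_v| <= w_e ^ ((p - r) / p) * (m_e / r) ^ (r / p),
    where [w_e] is the product of the [d_v ^ (1 / (p - r))] and [m_e] the sum of
    the [|x_v| ^ p / d_v] over [v] in [e].  Summing over the edges with Hölder's
    inequality for the exponents [p / (p - r)] and [p / r] gives the bound, since
    every vertex [v] lies in exactly [d_v] edges, so that the [m_e] add up to at
    most [\sum_v |x_v| ^ p = 1]. *)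
Require Import Defs.
From mathcomp Require Import all_boot all_order all_algebra.
From mathcomp Require Import all_classical all_reals all_analysis.
From mathcomp Require Import ring.

Import Order.TTheory GRing.Theory Num.Theory.
Import numFieldNormedType.Exports.

Local Open Scope ring_scope.

Lemma powR_prod (R : realType) (I : Type) (l : seq I) (P : pred I)
    (f : I -> R) (a : R) : (forall i, P i -> 0 <= f i) ->
  (\prod_(i <- l | P i) f i) `^ a = \prod_(i <- l | P i) f i `^ a.
Proof.
move=> f0; suff [] : 0 <= \prod_(i <- l | P i) f i /\
  (\prod_(i <- l | P i) f i) `^ a = \prod_(i <- l | P i) f i `^ a by [].
elim/big_rec2: _ => [|i y z Pi [z0 <-]]; first by rewrite powR1.
by rewrite mulr_ge0 ?powRM ?f0.
Qed.

(** Young's inequality for the conjugate exponents [s^-1] and [t^-1], applied to [a]^ s[and]b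
    [^ t]. *)
Lemma powR_young (R : realType) (a b s t : R) : 0 <= a -> 0 <= b ->
  0 < s -> 0 < t -> s + t = 1 -> a `^ s * b `^ t <= s * a + t * b.
Proof.
move=> a0 b0 s0 t0 st.
have := @conjugate_powR R (a `^ s) (b `^ t) s^-1 t^-1.
rewrite !invrK -!powRrM !mulfV ?gt_eqF// !powRr1// (mulrC a) (mulrC b).
by apply; rewrite ?powR_ge0 ?invr_gt0.
Qed.

(** Divide [f] and [g] by their sums and apply [powR_young] to each term; the normalised bounds add
    up to [s + t = 1]. *)
Lemma hoelder_sum (R : realType) (I : finType) (P : pred I)
    (f g : I -> R) (s t : R) :
  (forall i, P i -> 0 <= f i) -> (forall i, P i -> 0 <= g i) ->
  0 < s -> 0 < t -> s + t = 1 ->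
  \sum_(i | P i) f i `^ s * g i `^ t <=
  (\sum_(i | P i) f i) `^ s * (\sum_(i | P i) g i) `^ t.
Proof.
move=> f0 g0 s0 t0 st.
set F := \sum_(i | P i) f i; set G := \sum_(i | P i) g i.
have F0 : 0 <= F by exact: sumr_ge0.
have G0 : 0 <= G by exact: sumr_ge0.
(* A zero sum cannot be divided by, but then every term of it vanishes, and so does its power
   because the exponent is positive. *)
have [FE|Fn0] := eqVneq F 0.
  rewrite FE powR0 ?gt_eqF// mul0r big1// => i Pi.
  by rewrite (psumr_eq0P f0 FE)// powR0 ?gt_eqF// mul0r.
have [GE|Gn0] := eqVneq G 0.
  rewrite GE [0 `^ t]powR0 ?gt_eqF// mulr0 big1// => i Pi.
  by rewrite (psumr_eq0P g0 GE)// [0 `^ t]powR0 ?gt_eqF// mulr0.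
have young i : P i -> f i `^ s * g i `^ t <=
    F `^ s * G `^ t * (s * (f i / F) + t * (g i / G)).
  move=> Pi; have {1}-> : f i = F * (f i / F) by field.
  have {1}-> : g i = G * (g i / G) by field.
  have fF : 0 <= f i / F by rewrite divr_ge0 ?f0.
  have gG : 0 <= g i / G by rewrite divr_ge0 ?g0.
  rewrite (powRM _ F0 fF) (powRM _ G0 gG) mulrACA ler_wpM2l ?mulr_ge0 ?powR_ge0//.
  exact: powR_young.
apply: le_trans (ler_sum _ young) _.
rewrite -mulr_sumr big_split/= -!mulr_sumr -!mulr_suml -/F -/G !divff//.
by rewrite !mulr1 st mulr1.
Qed.

Lemma prod_le_powR_mean (R : realType) (I : finType) (A : {set I})
    (d x : I -> R) (p : R) : (0 < #|A|)%N -> #|A|%:R < p ->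
  (forall i, i \in A -> 0 < d i) -> (forall i, 0 <= x i) ->
  \prod_(i in A) x i <=
  (\prod_(i in A) d i `^ (p - #|A|%:R)^-1) `^ ((p - #|A|%:R) / p) *
  ((\sum_(i in A) x i `^ p / d i) / #|A|%:R) `^ (#|A|%:R / p).
Proof.
set r := #|A| => r0 rp d0 x0.
have p0 : 0 < p by apply: le_lt_trans rp.
have pr0 : 0 < p - r%:R by rewrite subr_gt0.
have q0 i : i \in A -> 0 <= x i `^ p / d i.
  by move=> iA; rewrite divr_ge0 ?powR_ge0 ?ltW ?d0.
have -> : \prod_(i in A) x i = (\prod_(i in A) d i) `^ p^-1 *
    (\prod_(i in A) (x i `^ p / d i)) `^ p^-1.
  have dA : 0 <= \prod_(i in A) d i by apply: prodr_ge0 => i /d0/ltW.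
  rewrite -(powRM _ dA (prodr_ge0 _ q0)) -big_split/= powR_prod => [|i iA].
    apply: eq_bigr => i iA.
    by rewrite mulrCA mulfV ?gt_eqF ?d0// mulr1 -powRrM mulfV ?gt_eqF// powRr1.
  by rewrite mulr_ge0 ?q0 ?ltW ?d0.
have <- : (\prod_(i in A) d i) `^ p^-1 =
    (\prod_(i in A) d i `^ (p - r%:R)^-1) `^ ((p - r%:R) / p).
  rewrite -powR_prod => [|i /d0/ltW//].
  by rewrite -powRrM mulrA mulVf ?gt_eqF// mul1r.
rewrite ler_wpM2l ?powR_ge0// powRrM powR_mulrn; last first.
  by rewrite divr_ge0 ?sumr_ge0.
have m0 : 0 <= (\sum_(i in A) x i `^ p / d i) / r%:R.
  by rewrite divr_ge0 ?sumr_ge0.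
apply: ge0_ler_powR; rewrite ?nnegrE ?invr_ge0 ?prodr_ge0 ?exprn_ge0 ?(ltW p0)//.
exact: (leif_AGM q0).
Qed.

(** Double counting: after exchanging the sums, the term of [v] occurs once for each of the
    [degree G v] edges through [v]. *)
Lemma sum_edges_degree (R : realType) (n r : nat) (G : hypergraph n r)
    (f : 'I_n -> R) : (forall v, 0 <= f v) ->
  \sum_(e in edges G) \sum_(v in e) f v / (degree G v)%:R <= \sum_v f v.
Proof.
move=> f0; rewrite (exchange_big_dep predT)//=; apply: ler_sum => v _.
rewrite sumr_const.
have -> : #|[pred e in edges G | v \in e]| = degree G v.
  by apply: eq_card => e; rewrite !inE.
(* An isolated vertex contributes 0 on the left, which is why only an inequality holds. *)
have [->|dv] := eqVneq (degree G v) 0; first by rewrite mulr0n.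
by rewrite -[leLHS]mulr_natr mulfVK ?pnatr_eq0.
Qed.

Lemma degree_gt0 (n r : nat) (G : hypergraph n r) (e : {set 'I_n}) (v : 'I_n) :
  e \in edges G -> v \in e -> (0 < degree G v)%N.
Proof. by move=> eG ve; apply/card_gt0P; exists e; rewrite inE eG. Qed.

Lemma polyform_le (R : realType) (n r : nat) (G : hypergraph n r) (p : R)
    (x : 'rV[R]_n) : r%:R < p -> pnorm p x = 1 ->
  polyform G x <=
  (r%:R * \sum_(e in edges G) \prod_(v in e) (degree G v)%:R `^ (p - r%:R)^-1)
    `^ ((p - r%:R) / p).
Proof.
move=> rp; have p0 : 0 < p by apply: le_lt_trans rp.
move=> /(pnorm_eq1 _ p0) x1; rewrite /polyform.
have [rE0|r0] := posnP r.
  by rewrite (_ : r%:R = 0 :> R) ?rE0// mul0r powR_ge0.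
have rR : 0 < r%:R :> R by rewrite ltr0n.
have pr0 : 0 < p - r%:R by rewrite subr_gt0.
pose w (e : {set 'I_n}) : R := \prod_(v in e) (degree G v)%:R `^ (p - r%:R)^-1.
pose m (e : {set 'I_n}) : R :=
  \sum_(v in e) `|x ord0 v| `^ p / (degree G v)%:R.
have w0 e : 0 <= w e by rewrite prodr_ge0// => v _; exact: powR_ge0.
have m0 e : 0 <= m e by rewrite sumr_ge0// => v _; rewrite divr_ge0 ?powR_ge0.
have st : (p - r%:R) / p + r%:R / p = 1 by rewrite -mulrDl subrK divff ?gt_eqF.
(* The prefactor [r] is split along the two Hölder exponents: one part joins [w e], the other
   cancels the denominator of the mean [m e / r%:R]. *)
have rE : r%:R `^ ((p - r%:R) / p) * r%:R `^ (r%:R / p) = r%:R :> R.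
  by rewrite -powRD st ?powRr1 ?ltW// oner_eq0.
have edge e : e \in edges G -> r%:R * \prod_(v in e) x ord0 v <=
    (r%:R * w e) `^ ((p - r%:R) / p) * m e `^ (r%:R / p).
  move=> eG; have er := edges_uniform eG.
  have xe : \prod_(v in e) x ord0 v <=
      w e `^ ((p - r%:R) / p) * (m e / r%:R) `^ (r%:R / p).
    (* Entries of [x] may be negative, while AM-GM needs nonnegative ones. *)
    apply: (@le_trans _ _ (\prod_(v in e) `|x ord0 v|)).
      by rewrite -normr_prod ler_norm.
    have := @prod_le_powR_mean R _ e (fun v => (degree G v)%:R)
      (fun v => `|x ord0 v|) p.
    rewrite er; apply => // v ve.
    by rewrite ltr0n (degree_gt0 _ _ _ _ _ eG ve).
  apply: le_trans (ler_wpM2l (ltW rR) xe) _.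
  rewrite -{1}rE mulrACA -!powRM ?divr_ge0//.
  by rewrite mulrCA divff ?gt_eqF// mulr1.
rewrite mulr_sumr; apply: le_trans (ler_sum _ edge) _.
apply: le_trans (hoelder_sum _ _ _ _ _ _ _ _ _ _ _ st) _ => //.
- by move=> e _; rewrite mulr_ge0.
- by rewrite divr_gt0.
- by rewrite divr_gt0.
(* The first Hölder factor is already the claimed bound; it remains to see that the second is at
   most 1. *)
rewrite -mulr_sumr ler_piMr ?powR_ge0//.
have m1 : \sum_(e in edges G) m e <= 1.
  by rewrite -x1; apply: sum_edges_degree => v; exact: powR_ge0.
apply: le_trans (ge0_ler_powR _ _ _ m1) _; last by rewrite powR1.
- by rewrite divr_ge0 ?ltW.
- by rewrite nnegrE sumr_ge0.
- by rewrite nnegrE.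
Qed.

Theorem theorem3p2 (R : realType) (n r : nat) (G : hypergraph n r) (p : R)
    (hp : r%:R < p) :
  p_spectral_radius G p <=
  (r%:R * \sum_(e in edges G) \prod_(v in e) (degree G v)%:R `^ (p - r%:R)^-1)
    `^ ((p - r%:R) / p).
Proof.
rewrite /p_spectral_radius; set B := (X in sup X).
(* Without unit vectors the supremum is 0 by convention, below any power. *)
have [->|B0] := eqVneq B set0; first by rewrite sup0 powR_ge0.
apply: ge_sup; first exact/set0P.
by move=> _ [x x1 <-]; exact: polyform_le.
Qed.
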